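(* Let $A=\begin{bmatrix} a & b & c\\ f & g & h\\ p & q & r\end{bmatrix}$ be a $3\times 3$ matrix with entries in the quaternions $\mathbb{H}$ such that $c\neq 0$, and let $\pi_A=g-hc^{-1}b$. Then the map $\mu\colon\mathbb{H}\to\mathbb{H}$ defined by $$\mu(\pi_A)=\left(q-(r-\pi_A)c^{-1}b\right)\left(f-hc^{-1}(a-\pi_A)\right)$$ and, for $\lambda\neq\pi_A$, $$\mu(\lambda)=(\pi_A-\lambda)\left[p-(r-\lambda)c^{-1}(a-\lambda)-\left(q-(r-\lambda)c^{-1}b\right)(\pi_A-\lambda)^{-1}\left(f-hc^{-1}(a-\lambda)\right)\right]$$ is a characteristic map of $A$.
   Context: For an $n\times n$ quaternionic matrix $M=X+\mathbf{j}Y$ with $X,Y$ complex $n\times n$ matrices, Study's determinant is the non-negative real number $\mathrm{Sdet}(M)=(\det c(M))^{1/2}$, where $c(M)=\begin{bmatrix} X & -\overline{Y}\\ Y&\overline{X}\end{bmatrix}$ is a complex $2n\times 2n$ matrix. A map $\mu\colon\mathbb{H}\to\mathbb{H}$ is a characteristic map of the $n\times n$ quaternionic matrix $A$ if, up to a (positive) constant factor, $|\mu(\lambda)|=\mathrm{Sdet}(A-\lambda\,\mathrm{Id})$ for all $\lambda\in\mathbb{H}$. The point $\pi_A$ is called the pole of $A$. *)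

(* Defs.v *)
From HB Require Import structures.
From mathcomp Require Import all_boot all_order all_algebra.
From mathcomp Require Import ring.
From mathcomp Require Import complex.

Set Implicit Arguments.
Unset Strict Implicit.
Unset Printing Implicit Defensive.

Import Order.TTheory GRing.Theory Num.Theory.
Local Open Scope ring_scope.

(* [Quat t x y z] is t + x i + y j + z k. *)
Record quat (R : Type) : Type := Quat { qre : R; qi : R; qj : R; qk : R }.

Section QuatStructures.
Variable R : rcfType.
Local Notation H := (quat R).

Let to_prod (u : H) : R * R * R * R := (qre u, qi u, qj u, qk u).
Let of_prod (v : R * R * R * R) : H :=
  let: (t, x, y, z) := v in Quat t x y z.
Let to_prodK : cancel to_prod of_prod. Proof. by case. Qed.

HB.instance Definition _ := Equality.copy H (can_type to_prodK).
HB.instance Definition _ := Choice.copy H (can_type to_prodK).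

Definition qzero : H := Quat 0 0 0 0.
Definition qone : H := Quat 1 0 0 0.
Definition qopp (u : H) : H := Quat (- qre u) (- qi u) (- qj u) (- qk u).
Definition qadd (u v : H) : H :=
  Quat (qre u + qre v) (qi u + qi v) (qj u + qj v) (qk u + qk v).
Definition qmul (u v : H) : H :=
  Quat (qre u * qre v - qi u * qi v - qj u * qj v - qk u * qk v)
       (qre u * qi v + qi u * qre v + qj u * qk v - qk u * qj v)
       (qre u * qj v - qi u * qk v + qj u * qre v + qk u * qi v)
       (qre u * qk v + qi u * qj v - qj u * qi v + qk u * qre v).

Definition qnorm2 (u : H) : R := qre u ^+ 2 + qi u ^+ 2 + qj u ^+ 2 + qk u ^+ 2.
Definition qinv (u : H) : H :=
  Quat (qre u / qnorm2 u) (- qi u / qnorm2 u)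
       (- qj u / qnorm2 u) (- qk u / qnorm2 u).

Lemma qaddA : associative qadd.
Proof. by move=> u v w; congr Quat; rewrite /= addrA. Qed.
Lemma qaddC : commutative qadd.
Proof. by move=> u v; congr Quat; rewrite /= addrC. Qed.
Lemma qadd0 : left_id qzero qadd.
Proof. by case=> t x y z; congr Quat; rewrite /= add0r. Qed.
Lemma qaddN : left_inverse qzero qopp qadd.
Proof. by case=> t x y z; congr Quat; rewrite /= addNr. Qed.

HB.instance Definition _ :=
  GRing.isZmodule.Build H qaddA qaddC qadd0 qaddN.

Lemma qmulA : associative qmul.
Proof. by move=> u v w; congr Quat => /=; ring. Qed.
Lemma qmul1q : left_id qone qmul.
Proof. by case=> t x y z; congr Quat => /=; ring. Qed.
Lemma qmulq1 : right_id qone qmul.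
Proof. by case=> t x y z; congr Quat => /=; ring. Qed.
Lemma qmulDl : left_distributive qmul +%R.
Proof. by move=> u v w; congr Quat => /=; ring. Qed.
Lemma qmulDr : right_distributive qmul +%R.
Proof. by move=> u v w; congr Quat => /=; ring. Qed.
Lemma qone_neq0 : qone != 0.
Proof. by apply/eqP => -[] /eqP; rewrite oner_eq0. Qed.

HB.instance Definition _ :=
  GRing.Zmodule_isNzRing.Build H qmulA qmul1q qmulq1 qmulDl qmulDr qone_neq0.

Lemma qnorm2_eq0 (u : H) : (qnorm2 u == 0) = (u == 0).
Proof.
apply/idP/eqP => [|->]; last by rewrite /qnorm2 /= !expr0n /= !addr0.
rewrite /qnorm2 !paddr_eq0 ?addr_ge0 ?sqr_ge0 // !sqrf_eq0.
by case: u => t x y z /= /andP[/andP[/andP[/eqP -> /eqP ->] /eqP ->] /eqP ->].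
Qed.

Lemma qmulVq : {in [pred u : H | u != 0], left_inverse 1 qinv *%R}.
Proof.
move=> u; rewrite inE -qnorm2_eq0 => n0.
by congr Quat; rewrite /= /qnorm2 in n0 *; field.
Qed.

Lemma qmulqV : {in [pred u : H | u != 0], right_inverse 1 qinv *%R}.
Proof.
move=> u; rewrite inE -qnorm2_eq0 => n0.
by congr Quat; rewrite /= /qnorm2 in n0 *; field.
Qed.

Lemma qunitP (u v : H) : v * u = 1 /\ u * v = 1 -> [pred u : H | u != 0] u.
Proof.
by case=> vu _ /=; apply/eqP => u0; move: vu; rewrite u0 mulr0 => /esym/eqP; rewrite oner_eq0.
Qed.

Lemma qinv_out : {in [predC [pred u : H | u != 0]], qinv =1 id}.
Proof.
by move=> u; rewrite !inE negbK => /eqP ->; congr Quat; rewrite /= ?oppr0 mul0r.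
Qed.

HB.instance Definition _ :=
  GRing.NzRing_hasMulInverse.Build H qmulVq qmulqV qunitP qinv_out.

End QuatStructures.

Section StudyDeterminant.
Variable R : rcfType.
Local Open Scope complex_scope.

Definition qnorm (u : quat R) : R := Num.sqrt (qnorm2 u).

(* Every quaternion is uniquely x + j y with x, y complex; since j i = - k,
   the second component of t + x i + y j + z k is y - z i. *)
Definition qofC (x : R[i]) : quat R := Quat (complex.Re x) (complex.Im x) 0 0.
Definition qunit_j : quat R := Quat 0 0 1 0.
Definition qcplx1 (u : quat R) : R[i] := qre u +i* qi u.
Definition qcplx2 (u : quat R) : R[i] := qj u -i* qk u.

Lemma qcplxE (u : quat R) : u = qofC (qcplx1 u) + qunit_j * qofC (qcplx2 u).
Proof. by case: u => t x y z; congr Quat => /=; ring. Qed.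

Lemma qcplx_uniq (x y : R[i]) (u : quat R) :
  u = qofC x + qunit_j * qofC y -> x = qcplx1 u /\ y = qcplx2 u.
Proof.
by case: x y => [x1 x2] [y1 y2] ->; split; congr Complex => /=; ring.
Qed.

Definition cmx n (M : 'M[quat R]_n) : 'M[R[i]]_(n + n) :=
  let X := map_mx qcplx1 M in
  let Y := map_mx qcplx2 M in
  block_mx X (- map_mx conjc Y) Y (map_mx conjc X).

(* Complex-valued: it is a theorem that [\det (cmx M)] is real and nonnegative,
   in which case [sqrtC] is its usual square root. *)
Definition Sdet n (M : 'M[quat R]_n) : R[i] := sqrtC (\det (cmx M)).

Definition characteristic_map n (A : 'M[quat R]_n) (mu : quat R -> quat R) :=
  exists2 k : R, 0 < k &
    forall l : quat R, (k * qnorm (mu l))%:C = Sdet (A - l%:M).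

Definition mx33 (a b c f g h p q r : quat R) : 'M[quat R]_3 :=
  \matrix_(i < 3, j < 3)
    nth 0 (nth [::] [:: [:: a; b; c]; [:: f; g; h]; [:: p; q; r]] i) j.

End StudyDeterminant.

(* Main.v *)
Require Import Defs.
From mathcomp Require Import all_boot all_order all_algebra.
From mathcomp Require Import reals.
From mathcomp Require Import perm complex ring.

Set Implicit Arguments.
Unset Strict Implicit.
Unset Printing Implicit Defensive.

Import GRing.Theory Num.Theory.
Local Open Scope ring_scope.

(** The number [\det (cmx M)], the square of Study's determinant, behaves over
    the noncommutative quaternions as a determinant should.  Since
    [M |-> cmx M] is multiplicative ([cmxM]), it is multiplicative in [M]; it
    does not change under row permutations ([det_cmx_row_perm]), and on a
    lower triangular matrix it is the product of the squared norms of the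
    diagonal entries ([det_cmx_trig]).  Hence it can be computed by Gaussian
    elimination, with quaternionic multipliers acting on the left.

    For [A - l%:M], the entry [c] is a pivot for all [l] at once.  Clearing
    the rest of its column leaves, with [w := piA - l], the block
    [[
         f'  w          f' = f - h c^-1 (a - l)
         p'  q'         p' = p - (r - l) c^-1 (a - l)
                        q' = q - (r - l) c^-1 b
    ]]
    in the first two columns of the last two rows: the pole is exactly the
    point where [w] vanishes.  Away from it, [w] is the next pivot, the last
    one is [p' - q' w^-1 f'], and the Study determinant is
    [|c| |w| |p' - q' w^-1 f'|].  At the pole the block is already lower
    triangular, and the Study determinant is [|c| |q'| |f'|].  Both
    values are [|c| |mu l|], so the constant factor is [|c|]. *)

Section ComplexForm.
Variable R : rcfType.
Local Open Scope complex_scope.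
Implicit Types u v : quat R.

Lemma qnorm2M u v : qnorm2 (u * v) = qnorm2 u * qnorm2 v.
Proof. by rewrite /qnorm2 /=; ring. Qed.

Lemma qnorm2_ge0 u : 0 <= qnorm2 u.
Proof. by rewrite /qnorm2 !addr_ge0 ?sqr_ge0. Qed.

(** The complex form is that of left multiplication on the right complex space
    [C + j C]: the conjugates come from [x j = j x^*]. *)
Lemma qcplx1M u v :
  qcplx1 (u * v) = qcplx1 u * qcplx1 v - (qcplx2 u)^*%C * qcplx2 v.
Proof. by congr Complex => /=; ring. Qed.

Lemma qcplx2M u v :
  qcplx2 (u * v) = qcplx2 u * qcplx1 v + (qcplx1 u)^*%C * qcplx2 v.
Proof. by congr Complex => /=; ring. Qed.

Lemma qcplx1_sum I (s : seq I) (F : I -> quat R) :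
  qcplx1 (\sum_(i <- s) F i) = \sum_(i <- s) qcplx1 (F i).
Proof. by apply: big_morph => // u v; congr Complex => /=; ring. Qed.

Lemma qcplx2_sum I (s : seq I) (F : I -> quat R) :
  qcplx2 (\sum_(i <- s) F i) = \sum_(i <- s) qcplx2 (F i).
Proof.
by apply: big_morph => [u v|]; congr Complex => /=; ring.
Qed.

Lemma qcplx2_0 : qcplx2 (0 : quat R) = 0.
Proof. by congr Complex => /=; ring. Qed.

Lemma map_qcplx1M m n p (M : 'M[quat R]_(m, n)) (N : 'M[quat R]_(n, p)) :
  map_mx (@qcplx1 R) (M *m N) =
    map_mx (@qcplx1 R) M *m map_mx (@qcplx1 R) N
      - map_mx (@conjc R) (map_mx (@qcplx2 R) M) *m map_mx (@qcplx2 R) N.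
Proof.
apply/matrixP => i j; rewrite !mxE qcplx1_sum -sumrB.
by apply: eq_bigr => k _; rewrite !mxE qcplx1M.
Qed.

Lemma map_qcplx2M m n p (M : 'M[quat R]_(m, n)) (N : 'M[quat R]_(n, p)) :
  map_mx (@qcplx2 R) (M *m N) =
    map_mx (@qcplx2 R) M *m map_mx (@qcplx1 R) N
      + map_mx (@conjc R) (map_mx (@qcplx1 R) M) *m map_mx (@qcplx2 R) N.
Proof.
apply/matrixP => i j; rewrite !mxE qcplx2_sum -big_split.
by apply: eq_bigr => k _; rewrite !mxE qcplx2M.
Qed.

Lemma map_conjcK m n (M : 'M[R[i]]_(m, n)) :
  map_mx (@conjc R) (map_mx (@conjc R) M) = M.
Proof. by apply/matrixP => i j; rewrite !mxE conjcK. Qed.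

Lemma cmxM n (M N : 'M[quat R]_n) : cmx (M *m N) = cmx M *m cmx N.
Proof.
rewrite /cmx mulmx_block map_qcplx1M map_qcplx2M.
rewrite map_mxB map_mxD !map_mxM !map_conjcK mulNmx !mulmxN mulNmx.
congr block_mx; last by rewrite addrC.
by rewrite opprD addrC.
Qed.

(** A 0-1 matrix has no [j]-part, so its complex form repeats it twice on the
    diagonal and the sign of the permutation gets squared. *)
Lemma det_cmx_perm n (s : {perm 'I_n}) :
  \det (cmx (perm_mx s : 'M[quat R]_n)) = 1.
Proof.
have -> : cmx (perm_mx s : 'M[quat R]_n) = block_mx (perm_mx s) 0 0 (perm_mx s).
  congr block_mx; apply/matrixP => i j; rewrite !mxE;
    by case: (_ == _); congr Complex => /=; rewrite ?oppr0.
by rewrite det_ublock det_perm -expr2 sqrr_sign.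
Qed.

Lemma det_cmx_row_perm n (s : {perm 'I_n}) (M : 'M[quat R]_n) :
  \det (cmx (row_perm s M)) = \det (cmx M).
Proof. by rewrite row_permE cmxM det_mulmx det_cmx_perm mul1r. Qed.

(** Conjugation between index types that are only propositionally equal, as
    happens when blocks are rearranged. *)
Lemma det_conj_rect m n (mn : m = n) (M : 'M[R[i]]_m)
    (P : 'M_(n, m)) (Q : 'M_(m, n)) :
  Q *m P = 1%:M -> \det (P *m M *m Q) = \det M.
Proof.
case: n / mn P Q => P Q QP1.
by rewrite !det_mulmx mulrAC mulrC [\det P * _]mulrC -det_mulmx QP1 det1 mulr1.
Qed.

(** Reordering the rows and columns of the complex form from (X-part, Y-part) to
    (first block, second block) turns a block lower triangular quaternionic
    matrix into a block lower triangular complex one. *)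
Lemma det_cmx_lblock m n (A : 'M[quat R]_m) (C : 'M_(n, m)) (D : 'M_n) :
  \det (cmx (block_mx A 0 C D)) = \det (cmx A) * \det (cmx D).
Proof.
have mn : (m + n + (m + n) = m + m + (n + n))%N by rewrite addnACA.
(* [P] exchanges the two middle blocks of four, and [Q] is its inverse. *)
pose P : 'M[R[i]]_(m + m + (n + n), m + n + (m + n)) :=
  block_mx (block_mx 1%:M 0 0 0) (block_mx 0 0 1%:M 0)
           (block_mx 0 1%:M 0 0) (block_mx 0 0 0 1%:M).
pose Q : 'M[R[i]]_(m + n + (m + n), m + m + (n + n)) :=
  block_mx (block_mx 1%:M 0 0 0) (block_mx 0 0 1%:M 0)
           (block_mx 0 1%:M 0 0) (block_mx 0 0 0 1%:M).
have QP1 : Q *m P = 1%:M.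
  rewrite /P /Q !mulmx_block !(mulmx0, mul0mx, mulmx1, addr0, add0r).
  by rewrite !add_block_mx !(addr0, add0r) -!scalar_mx_block block_mx0 -scalar_mx_block.
have c1_0 : map_mx (@qcplx1 R) (0 : 'M_(m, n)) = 0.
  by apply/matrixP => i j; rewrite !mxE.
have c2_0 : map_mx (@qcplx2 R) (0 : 'M_(m, n)) = 0.
  by apply/matrixP => i j; rewrite !mxE qcplx2_0.
pose C1 := map_mx (@qcplx1 R) C; pose C2 := map_mx (@qcplx2 R) C.
pose cC := block_mx C1 (- map_mx (@conjc R) C2) C2 (map_mx (@conjc R) C1).
transitivity (\det (block_mx (cmx A) 0 cC (cmx D))); last by rewrite det_lblock.
rewrite -(det_conj_rect mn _ QP1); congr (\det _).
rewrite /cmx !map_block_mx c1_0 c2_0 !map_mx0 /P /Q !opp_block_mx oppr0.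
pose simpmx := (mulmx0, mul0mx, mulmx1, mul1mx, addr0, add0r).
by do 2!(rewrite !mulmx_block !simpmx !add_block_mx !simpmx); rewrite block_mx0.
Qed.

Lemma det_mx2 (K : comPzRingType) (M : 'M[K]_2) :
  \det M = M 0 0 * M 1 1 - M 0 1 * M 1 0.
Proof.
rewrite (expand_det_row _ 0) !big_ord_recl big_ord0 addr0 /cofactor !det_mx11.
rewrite !mxE /= expr0 expr1 mul1r mulN1r mulrN.
by congr (_ * M _ _ - M _ _ * M _ _); apply: val_inj.
Qed.

(** The index types ['I_2] and ['I_(1 + 1)] carry different-looking zeros and
    ones, so the entries are matched by value. *)
Lemma det_block11 (K : comPzRingType) (A B C D : 'M[K]_1) :
  \det (block_mx A B C D) = A 0 0 * D 0 0 - B 0 0 * C 0 0.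
Proof.
rewrite -(block_mxEul A B C D) -[D 0 0](block_mxEdr A B C D).
rewrite -(block_mxEur A B C D) -[C 0 0](block_mxEdl A B C D).
move: (block_mx A B C D) => M; rewrite [LHS]det_mx2.
by congr (M _ _ * M _ _ - M _ _ * M _ _); apply: val_inj.
Qed.

Lemma det_cmx11 (M : 'M[quat R]_1) : \det (cmx M) = (qnorm2 (M 0 0))%:C.
Proof.
rewrite det_block11 !mxE.
by congr Complex; rewrite /qnorm2 /=; ring.
Qed.

(** This gives in particular the reality and nonnegativity that make [sqrtC]
    behave as a real square root. *)
Lemma det_cmx_trig n (M : 'M[quat R]_n) :
  is_trig_mx M -> \det (cmx M) = (\prod_i qnorm2 (M i i))%:C.
Proof.
elim/trigsqmx_ind => [|k x c B Bt IHB]; first by rewrite big_ord0 det_mx00.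
rewrite det_cmx_lblock det_cmx11 IHB big_ord_recl -rmorphM; congr (_ * _)%:C.
  by rewrite -[ord0](lshift0 _ 0) block_mxEul.
by apply: eq_bigr => i; rewrite -!rshift1 block_mxEdr.
Qed.

(** It suffices to exhibit the determinant as the squared norm of some
    quaternion. *)
Lemma Sdet_of_qnorm2 n (M : 'M[quat R]_n) u :
  \det (cmx M) = (qnorm2 u)%:C -> Sdet M = (qnorm u)%:C.
Proof.
move=> detM; rewrite /Sdet detM -(sqr_sqrtr (qnorm2_ge0 u)) rmorphXn /=.
by rewrite sqrCK // ler0c sqrtr_ge0.
Qed.

Lemma det_cmx_mx33_trig (a f g p q r : quat R) :
  \det (cmx (mx33 a 0 0 f g 0 p q r)) =
    (qnorm2 a * qnorm2 g * qnorm2 r)%:C.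
Proof.
rewrite det_cmx_trig; first by rewrite !big_ord_recl big_ord0 !mxE /= mulr1 mulrA.
apply/is_trig_mxP => -[[|[|[|i]]] ?] // [[|[|[|j]]] ?] //; by rewrite mxE.
Qed.

Lemma mulmx33 (a b c f g h p q r a' b' c' f' g' h' p' q' r' : quat R) :
  mx33 a b c f g h p q r *m mx33 a' b' c' f' g' h' p' q' r' =
  mx33 (a * a' + b * f' + c * p') (a * b' + b * g' + c * q')
         (a * c' + b * h' + c * r')
       (f * a' + g * f' + h * p') (f * b' + g * g' + h * q')
         (f * c' + g * h' + h * r')
       (p * a' + q * f' + r * p') (p * b' + q * g' + r * q')
         (p * c' + q * h' + r * r').
Proof.
apply/matrixP => -[[|[|[|i]]] ?] // [[|[|[|j]]] ?] //;
  by rewrite mxE !big_ord_recl big_ord0 !mxE /= addr0 addrA.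
Qed.

Lemma det_cmx_mx33_swap12 (a b c f g h p q r : quat R) :
  \det (cmx (mx33 f g h a b c p q r)) = \det (cmx (mx33 a b c f g h p q r)).
Proof.
rewrite -(det_cmx_row_perm (tperm 0 1)); congr (\det (cmx _)).
apply/matrixP => i j; rewrite !mxE.
by case: i => [[|[|[|i]]] ?] //; rewrite permE.
Qed.

Lemma det_cmx_mx33_swap23 (a b c f g h p q r : quat R) :
  \det (cmx (mx33 a b c p q r f g h)) = \det (cmx (mx33 a b c f g h p q r)).
Proof.
rewrite -(det_cmx_row_perm (tperm 1 2%:R)); congr (\det (cmx _)).
apply/matrixP => i j; rewrite !mxE.
by case: i => [[|[|[|i]]] ?] //; rewrite permE.
Qed.

(** One elimination step.  The multipliers stand on the left because a row
    operation is a left multiplication, here by a unitriangular matrix. *)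
Lemma det_cmx_mx33_rowop (s t u a b c f g h p q r : quat R) :
  \det (cmx (mx33 a b c f g h p q r)) =
  \det (cmx (mx33 a b c (s * a + f) (s * b + g) (s * c + h)
     (t * a + u * f + p) (t * b + u * g + q) (t * c + u * h + r))).
Proof.
transitivity (\det (cmx (mx33 1 0 0 s 1 0 t u 1 *m mx33 a b c f g h p q r))).
  rewrite cmxM det_mulmx det_cmx_mx33_trig.
  by rewrite /qnorm2 /= expr1n expr0n !addr0 !mulr1 mul1r.
by rewrite mulmx33 !mul1r !mul0r !addr0.
Qed.

End ComplexForm.

Theorem proposition36 (R : realType) (a b c f g h p q r : quat R)
    (c_neq0 : c != 0) (piA : quat R) (piAE : piA = g - h * c^-1 * b)
    (mu : quat R -> quat R)
    (mu_pole : mu piA =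
       (q - (r - piA) * c^-1 * b) * (f - h * c^-1 * (a - piA)))
    (mu_nonpole : forall l : quat R, l != piA ->
       mu l = (piA - l) *
         (p - (r - l) * c^-1 * (a - l)
            - (q - (r - l) * c^-1 * b) * (piA - l)^-1
                * (f - h * c^-1 * (a - l)))) :
  characteristic_map (mx33 a b c f g h p q r) mu.
Proof.
exists (qnorm c) => [|l].
  by rewrite sqrtr_gt0 lt0r qnorm2_eq0 c_neq0 qnorm2_ge0.
have -> : qnorm c * qnorm (mu l) = qnorm (c * mu l).
  by rewrite /qnorm qnorm2M sqrtrM // qnorm2_ge0.
apply/esym/Sdet_of_qnorm2.
have -> : mx33 a b c f g h p q r - l%:M =
          mx33 (a - l) b c f (g - l) h p q (r - l).
  apply/matrixP => -[[|[|[|i]]] ?] // [[|[|[|j]]] ?] //;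
    by rewrite !mxE /= ?mulr1n ?mulr0n ?subr0.
have c_unit : c \is a GRing.unit by [].
(* Clear the last column below the pivot [c]. *)
rewrite (det_cmx_mx33_rowop (- (h * c^-1)) (- ((r - l) * c^-1)) 0).
rewrite !mulNr !mulrVK // !mul0r !addr0 !addNr.
have -> : - (h * c^-1 * b) + (g - l) = piA - l.
  by rewrite piAE addrA [- _ + _]addrC.
rewrite ![- _ + _]addrC.
have [->|l_pole] := eqVneq l piA.
  (* With [w = 0], rotating the pivot row to the bottom is enough. *)
  rewrite mu_pole subrr det_cmx_mx33_swap12 det_cmx_mx33_swap23.
  by rewrite det_cmx_mx33_trig !qnorm2M; congr (_%:C)%C; ring.
rewrite mu_nonpole //.
set w := piA - l; set q' := q - _; set f' := f - _; set p' := p - _.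
have w_unit : w \is a GRing.unit by rewrite unfold_in /= subr_eq0 eq_sym.
(* Clear [q'] with the pivot [w]; reversing the rows makes it triangular. *)
rewrite (det_cmx_mx33_rowop 0 0 (- (q' * w^-1))).
rewrite !mul0r !add0r !mulr0 add0r !mulNr mulrVK // addNr.
rewrite [- _ + _]addrC.
rewrite det_cmx_mx33_swap12 det_cmx_mx33_swap23 det_cmx_mx33_swap12.
by rewrite det_cmx_mx33_trig !qnorm2M; congr (_%:C)%C; ring.
Qed.
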